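(* Let $E=(B,X,A,\alpha,\beta,\kappa,\lambda)$ and $F=(D,Y,B,\gamma,\delta,\mu,\nu)$ be split extensions of magmas. If $E$ is firm, then the pair $(F,E)$ is composable.
   Context: A (unitary) magma is a set $M$ with an element $0$ and a binary operation $+$ satisfying $0+x=x=x+0$ for all $x\in M$ (no other axiom). A magma homomorphism is a map preserving $0$ and $+$. Sums of maps are taken pointwise; $1$ denotes identity maps and $0$ also denotes constant zero maps. Split extension of magmas: a seven-tuple $E=(B,X,A,\alpha,\beta,\kappa,\lambda)$ where $B,X,A$ are magmas, $\alpha:A\to B$, $\beta:B\to A$, $\kappa:X\to A$ are magma homomorphisms, $\lambda:A\to X$ is a map with $\lambda(0)=0$ (not necessarily preserving addition), and, for all $x\in X$, $a\in A$, $b\in B$: $\lambda\kappa=1$, $\alpha\beta=1$; $\lambda\beta=0$, $\alpha\kappa=0$; $\kappa\lambda+\beta\alpha=1$; $\lambda(\kappa(x)+\beta(b))=x$; $\kappa(x)+(\beta(b)+a)=(\kappa(x)+\beta(b))+a$; $\kappa(x)+(a+\beta(b))=(\kappa(x)+a)+\beta(b)$; $a+(\kappa(x)+\beta(b))=(a+\kappa(x))+\beta(b)$. The associated action of $B$ on $X$ is $bx=\lambda(\beta(b)+\kappa(x))$. The split extension $E$ is called firm if $b'(bx)=(b'+b)x$ for all $b,b'\in B$, $x\in X$, for this associated action. For split extensions $E=(B,X,A,\alpha,\beta,\kappa,\lambda)$ and $F=(D,Y,B,\gamma,\delta,\mu,\nu)$, put $Z=\alpha^{-1}(\mu(Y))$,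 a submagma of $A$, let $\mu':Z\to A$ be the inclusion, and let $\nu':A\to Z$ be defined by $\nu'(a)=\kappa\lambda(a)+\beta\mu\nu\alpha(a)$. The pair $(F,E)$ is called composable if the seven-tuple $(D,Z,A,\gamma\alpha,\beta\delta,\mu',\nu')$ is a split extension of magmas. *)

(* Defs.v *)
(* Mathematical Components, with the classical sets of MathComp-Analysis for
   the image of a homomorphism. *)
From HB Require Import structures.
From mathcomp Require Import all_boot.
From mathcomp Require Import boolp classical_sets.

Set Implicit Arguments.
Unset Strict Implicit.
Unset Printing Implicit Defensive.

(* A magma with unit, possibly neither commutative nor associative, is a
   [umagmaType]. That structure is written multiplicatively in the library
   (the additive [addUMagmaType] is commutative); [0] and [+] below are additive
   notations for its unit [one] and its operation [mul]. *)
Declare Scope magma_scope.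
Delimit Scope magma_scope with M.
Notation "0" := (@monoid.one _) : magma_scope.
Notation "x + y" := (@monoid.mul _ x y) : magma_scope.
Notation "{ 'umagma' A -> B }" := (UMagmaMorphism.type A%type B%type)
  (at level 0, A at level 98, B at level 99,
   format "{ 'umagma'  A  ->  B }") : type_scope.

Local Open Scope classical_set_scope.
Local Open Scope magma_scope.

Record is_split_extension (B X A : umagmaType)
    (alpha : {umagma A -> B}) (beta : {umagma B -> A})
    (kappa : {umagma X -> A}) (lambda : A -> X) : Prop := IsSplitExtension {
  lambda_0 : lambda 0 = 0;
  lambda_kappa : forall x, lambda (kappa x) = x;
  alpha_beta : forall b, alpha (beta b) = b;
  lambda_beta : forall b, lambda (beta b) = 0;
  alpha_kappa : forall x, alpha (kappa x) = 0;
  kappa_lambda_D_beta_alpha :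
    forall a, kappa (lambda a) + beta (alpha a) = a;
  lambda_kappa_D_beta : forall x b, lambda (kappa x + beta b) = x;
  kappa_beta_A : forall x b a,
    kappa x + (beta b + a) = (kappa x + beta b) + a;
  kappa_A_beta : forall x a b,
    kappa x + (a + beta b) = (kappa x + a) + beta b;
  A_kappa_beta : forall a x b,
    a + (kappa x + beta b) = (a + kappa x) + beta b
}.

Record split_extension (B X A : umagmaType) := SplitExtension {
  se_alpha : {umagma A -> B};
  se_beta : {umagma B -> A};
  se_kappa : {umagma X -> A};
  se_lambda : A -> X;
  split_extensionP : is_split_extension se_alpha se_beta se_kappa se_lambda
}.

Definition action (B X A : umagmaType) (E : split_extension B X A)
    (b : B) (x : X) : X :=
  se_lambda E (se_beta E b + se_kappa E x).

Definition firm (B X A : umagmaType) (E : split_extension B X A) : Prop :=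
  forall (b b' : B) (x : X),
    action E b' (action E b x) = action E (b' + b) x.

Definition preim_range (A B Y : umagmaType)
    (alpha : {umagma A -> B}) (mu : {umagma Y -> B}) : set A :=
  alpha @^-1` range mu.

Record submagma_preim_range (A B Y : umagmaType)
    (alpha : {umagma A -> B}) (mu : {umagma Y -> B}) := SubmagmaPreimRange {
  preim_range_val : A;
  preim_range_valP : preim_range_val \in preim_range alpha mu
}.

Section SubmagmaPreimRange.
Variables (A B Y : umagmaType) (alpha : {umagma A -> B}) (mu : {umagma Y -> B}).

Local Notation Z := (submagma_preim_range alpha mu).

HB.instance Definition _ := [isSub for @preim_range_val A B Y alpha mu].
HB.instance Definition _ := [Choice of Z by <:].

Fact preim_range_umagma_closed : umagma_closed [in preim_range alpha mu].
Proof.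
split=> [|a a']; first by apply/mem_set; exists 0; rewrite ?gmulf1.
move=> /set_mem[y _ ya] /set_mem[y' _ ya']; apply/mem_set.
by exists (y + y'); rewrite ?gmulfM ?ya ?ya'.
Qed.

HB.instance Definition _ :=
  SubChoice_isSubUMagma.Build A _ Z preim_range_umagma_closed.

End SubmagmaPreimRange.

(* With E = (B, X, A, alpha, beta, kappa, lambda) and
   F = (D, Y, B, gamma, delta, mu, nu), [composite_kappa] is the inclusion mu'
   of Z = alpha^-1(mu(Y)) in A, and [composite_lambda] is the map
   nu' = kappa lambda + beta mu nu alpha from A to Z. *)
Section Composite.
Variables (B X A D Y : umagmaType).
Variables (F : split_extension D Y B) (E : split_extension B X A).

Local Notation Z := (submagma_preim_range (se_alpha E) (se_kappa F)).

Fact composite_lambda_subproof (a : A) :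
  se_kappa E (se_lambda E a)
    + se_beta E (se_kappa F (se_lambda F (se_alpha E a)))
  \in preim_range (se_alpha E) (se_kappa F).
Proof.
apply/mem_set; exists (se_lambda F (se_alpha E a)) => //.
have EP := split_extensionP E.
by rewrite gmulfM (alpha_kappa EP) (alpha_beta EP) mul1g.
Qed.

Definition composite_kappa : {umagma Z -> A} := (\val : Z -> A).

Definition composite_lambda (a : A) : Z :=
  SubmagmaPreimRange (composite_lambda_subproof a).

Definition composable : Prop :=
  is_split_extension (se_alpha F \o se_alpha E) (se_beta E \o se_beta F)
    composite_kappa composite_lambda.

End Composite.

(* Main.v *)
Require Import Defs.
From mathcomp Require Import all_boot.
From mathcomp Require Import boolp classical_sets.

(** In a split extension every element a of A is kappa x + beta b with
    (x, b) = (lambda a, alpha a), and is determined by this pair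
    ([split_ext_inj]). The three partial associativity laws force the addition
    of A to be that of a semidirect product ([lambdaD]):
      (x, b) + (x', b') = (x + b x', b + b').
    In these coordinates, Z is the set of the pairs (x, mu y), the new section
    is d |-> (0, delta d), and nu' is (x, b) |-> (x, mu (nu b)). An axiom of
    the composite that is an equality in A or in Z thus splits into an equality
    in B, which the same axiom of F gives, and an equality in X. The latter is
    immediate from b 0 = 0, except in the law that reassociates
    kappa + (beta + a): there it reads
      x + (mu y) ((delta d) x') = x + (mu y + delta d) x',
    which is an instance of firmness. *)

Local Open Scope magma_scope.

Section SplitExtensionTheory.
Variables (B X A : umagmaType) (E : split_extension B X A).

Let EP := split_extensionP E.

Lemma split_ext_inj (a a' : A) :
  se_lambda E a = se_lambda E a' -> se_alpha E a = se_alpha E a' -> a = a'.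
Proof.
by move=> eql eqa; rewrite -(kappa_lambda_D_beta_alpha EP a) eql eqa
  (kappa_lambda_D_beta_alpha EP).
Qed.

Lemma action_0r (b : B) : action E b 0 = 0.
Proof. by rewrite /action gmulf1 mulg1 (lambda_beta EP). Qed.

(** The action measures the failure of beta and kappa to commute: this is the
    decomposition of beta b + kappa x, whose image in B is b. *)
Lemma beta_kappaE (b : B) (x : X) :
  se_beta E b + se_kappa E x = se_kappa E (action E b x) + se_beta E b.
Proof.
by rewrite -[LHS](kappa_lambda_D_beta_alpha EP) gmulfM (alpha_beta EP)
  (alpha_kappa EP) mulg1.
Qed.

(** Decompose both summands, reassociate to bring beta b next to kappa x',
    exchange them by [beta_kappaE], and collect the kappa's and the beta's. *)
Lemma lambdaD (a a' : A) :
  se_lambda E (a + a')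
  = se_lambda E a + action E (se_alpha E a) (se_lambda E a').
Proof.
rewrite -{1}(kappa_lambda_D_beta_alpha EP a).
rewrite -{1}(kappa_lambda_D_beta_alpha EP a').
rewrite (A_kappa_beta EP) -(kappa_beta_A EP) beta_kappaE (A_kappa_beta EP).
by rewrite -gmulfM -(kappa_beta_A EP) -gmulfM (lambda_kappa_D_beta EP).
Qed.

End SplitExtensionTheory.

Theorem corollary3p6 (B X A D Y : umagmaType)
    (E : split_extension B X A) (F : split_extension D Y B) :
  firm E -> composable F E.
Proof.
move=> firmE; have EP := split_extensionP E; have FP := split_extensionP F.
have lambda_nu' a : se_lambda E (\val (composite_lambda F E a)) = se_lambda E a.
  by rewrite /= (lambda_kappa_D_beta EP).
have alpha_nu' a : se_alpha E (\val (composite_lambda F E a)) =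
    se_kappa F (se_lambda F (se_alpha E a)).
  by rewrite /= gmulfM (alpha_kappa EP) (alpha_beta EP) mul1g.
have alphaZ (z : submagma_preim_range (se_alpha E) (se_kappa F)) :
    exists y, se_alpha E (\val z) = se_kappa F y.
  by have /set_mem[y _ yz] := preim_range_valP z; exists y.
have lambda_betaE b := lambda_beta EP b.
split.
- apply/val_inj/(@split_ext_inj _ _ _ E); rewrite ?lambda_nu' ?alpha_nu' //.
  by rewrite !gmulf1 (lambda_0 FP) gmulf1.
- move=> z; apply/val_inj/(@split_ext_inj _ _ _ E).
    by rewrite lambda_nu'.
  have [y zy] := alphaZ z.
  by rewrite alpha_nu' /= zy (lambda_kappa FP).
- by move=> d /=; rewrite (alpha_beta EP) (alpha_beta FP).
- move=> d; apply/val_inj/(@split_ext_inj _ _ _ E).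
    by rewrite lambda_nu' /= lambda_betaE (lambda_0 EP).
  by rewrite alpha_nu' /= (alpha_beta EP) (lambda_beta FP) !gmulf1.
- by move=> z; have [y zy] := alphaZ z; rewrite /= zy (alpha_kappa FP).
- move=> a; apply: (@split_ext_inj _ _ _ E).
    by rewrite lambdaD lambda_nu' /= lambda_betaE action_0r mulg1.
  by rewrite gmulfM alpha_nu' /= (alpha_beta EP) (kappa_lambda_D_beta_alpha FP).
- move=> z d; apply/val_inj/(@split_ext_inj _ _ _ E).
    by rewrite lambda_nu' lambdaD /= lambda_betaE action_0r mulg1.
  have [y zy] := alphaZ z.
  rewrite alpha_nu' gmulfM /= zy (alpha_beta EP).
  by rewrite (lambda_kappa_D_beta FP).
- move=> z d a; have [y zy] := alphaZ z; apply: (@split_ext_inj _ _ _ E).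
    (* The component in X: once the zero components are removed,
       firmness merges the two successive actions, of delta d and of mu y. *)
    rewrite !lambdaD !gmulfM /= lambda_betaE (alpha_beta EP) action_0r.
    by rewrite mulg1 mul1g firmE.
  by rewrite !gmulfM /= zy (alpha_beta EP) (kappa_beta_A FP).
- move=> z a d; have [y zy] := alphaZ z; apply: (@split_ext_inj _ _ _ E).
    by rewrite !lambdaD /= lambda_betaE !action_0r !mulg1.
  by rewrite !gmulfM /= zy (alpha_beta EP) (kappa_A_beta FP).
- move=> a z d; have [y zy] := alphaZ z; apply: (@split_ext_inj _ _ _ E).
    by rewrite !lambdaD /= lambda_betaE !action_0r !mulg1.
  by rewrite !gmulfM /= zy (alpha_beta EP) (A_kappa_beta FP).
Qed.
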